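(* Let $\mathbb{A}$ be a finite alphabet, let $(\mu_\omega)_{\omega\in\Omega}$ be a finite nonempty family of finite, nonzero empirical measures on $\mathbb{A}$, and let $C$ be the convex hull of $\{\mu_\omega : \omega\in\Omega\}$. Let $\mathcal{L}$ be the set of functions $\ell:\mathbb{A}\to[0,\infty]$ that satisfy Kraft's Inequality $\sum_{a\in\mathbb{A}}\exp(-\ell(a))\le 1$. Assume that $\mu^*\in C$, $\ell^*\in\mathcal{L}$ and a constant $c\in\mathbb{R}$ satisfy \[ \sum_{a\in\mathbb{A}}\ell^*(a)\,\mu(a)\le c\quad\text{for all }\mu\in C, \qquad \sum_{a\in\mathbb{A}}\ell(a)\,\mu^*(a)\ge c\quad\text{for all }\ell\in\mathcal{L}. \] Assume that $\mu^*=\sum_{\omega\in\Omega}p_\omega\,\mu_\omega$ for a probability vector $(p_\omega)_{\omega\in\Omega}$. Then \[ \sum_{a\in\mathbb{A}}\ell^*(a)\,\mu_\omega(a)=c \] for all $\omega\in\Omega$ for which $p_\omega>0$. Further, $\mu^*$ has maximal entropy in $C$, i.e. $H(\mu^* )=\max_{\mu\in C}H(\mu)$, and $\ell^*(a)=\ln\left(\frac{\|\mu^*\|}{\mu^*(a)}\right)$ for all $a\in\mathbb{A}$.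
   Context: An empirical measure is a measure $\mu$ such that $\mu(A)$ is a (nonnegative) integer or $\infty$ for every measurable set $A$; here all empirical measures come from finite texts (letter counts), so they take finite integer values. For a measure $\mu$ on $\mathbb{A}$, $\|\mu\|=\mu(\mathbb{A})=\sum_{a}\mu(a)$. The entropy of a finite nonzero measure $\mu$ is $H(\mu)=\|\mu\|\cdot H(\mu/\|\mu\|)$, where for a probability measure $Q$ on $\mathbb{A}$, $H(Q)=-\sum_{a}Q(a)\ln Q(a)$ (with $0\ln 0=0$). Conventions: $\exp(-\infty)=0$, $\infty\cdot 0=0$, $\ln(x/0)=\infty$ for $x>0$. *)

(* Defs.v *)
From HB Require Import structures.
From mathcomp Require Import all_boot all_order all_algebra.
From mathcomp Require Import all_classical all_reals all_analysis.

Set Implicit Arguments.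
Unset Strict Implicit.
Unset Printing Implicit Defensive.

Import Order.TTheory GRing.Theory Num.Theory.
Import numFieldNormedType.Exports.

Local Open Scope classical_set_scope.
Local Open Scope ring_scope.

(* A finite measure on the finite alphabet A (all subsets being measurable) is
   represented by its point masses; R^o makes these an lmodType over R, hence
   the convex combinations available. Nonnegativity is not part of the type. *)
Notation mass R A := {ffun A -> R^o}.

Section Measures.
Variables (R : realType) (A : finType).
Implicit Types (mu : mass R A) (S : {set A}).

Definition measure_of mu S : R := \sum_(a in S) mu a.

Definition total_mass mu : R := measure_of mu [set: A]%SET.

(* Num.nat is the set of nonnegative integers of R, so this entails mu >= 0. *)
Definition empirical mu : Prop := forall S, measure_of mu S \is a Num.nat.

(* ln 0 = 0 in the library, and in any case it is multiplied by 0 here. *)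
Definition prob_entropy (Q : mass R A) : R := - \sum_a Q a * ln (Q a).

Definition entropy mu : R :=
  total_mass mu * prob_entropy ((total_mass mu)^-1 *: mu).

End Measures.

Definition convex_hull (R : numDomainType) (M : lmodType R) (X : set M) : set M :=
  smallest (@convex_set R M) X.

Section Codes.
Variables (R : realType) (A : finType).
Local Open Scope ereal_scope.

(* expeR -oo = 0, so a letter of infinite length contributes nothing. *)
Definition kraft : set (A -> \bar R) :=
  [set ell | (forall a, 0 <= ell a) /\ \sum_(a : A) expeR (- ell a) <= 1].

(* In \bar R one has +oo * 0 = 0. *)
Definition code_cost (ell : A -> \bar R) (mu : mass R A) : \bar R :=
  \sum_(a : A) ell a * (mu a)%:E.

End Codes.

(* Main.v *)
(* With N = ||nu|| and the subprobability q a = exp (- ell a), the inequality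
   1 + s <= expR s gives, letter by letter,
     ell a * nu a >= nu a * ln (N / nu a) + nu a - N * q a,
   with equality only if ell a = ln (N / nu a). Summing and using Kraft's
   inequality, entropy nu <= code_cost ell nu, with equality only for the
   Shannon code of nu. Hence c <= entropy mustar (test cost_ge on the Shannon
   code of mustar), while entropy nu <= code_cost ellstar nu <= c on C; at
   nu = mustar all these are equalities, which identifies ellstar. As the cost of
   mustar is the p-average of the costs of the mu w, all at most c, each one of
   positive weight equals c. *)

Require Import Defs.
From mathcomp Require Import all_boot all_order all_algebra.
From mathcomp Require Import ring.
From mathcomp Require Import all_classical all_reals all_analysis.

Set Implicit Arguments.
Unset Strict Implicit.
Unset Printing Implicit Defensive.

Import Order.TTheory GRing.Theory Num.Theory.
Import numFieldNormedType.Exports.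

Local Open Scope classical_set_scope.
Local Open Scope ring_scope.

(** A strict inequality at one index would survive adding the other terms, because those of [f] have
    a finite sum. The terms of [g] may be infinite. *)
Lemma sume_le_eq (R : realType) (I : finType) (f g : I -> \bar R) :
  (forall i, f i \is a fin_num) -> (forall i, f i <= g i)%E ->
  (\sum_i g i <= \sum_i f i)%E -> forall i, f i = g i.
Proof.
move=> ffin fg gf j; apply/eqP; rewrite eq_le fg leNgt; apply/negP => fgj.
move: gf; rewrite (bigD1 j)//= [X in (_ <= X)%E](bigD1 j)//= leNgt => /negP.
by apply; apply: lte_leD => //; [exact/sum_fin_numP | exact: lee_sum].
Qed.

Section LetterCost.
Variables (R : realType) (N : R).
Hypothesis N_gt0 : 0 < N.

(** The [q a] of the overview as a real number. For [0 <= l] nothing is lost by [fine], since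
    [expeR (- l)] is infinite only at [l = -oo]. *)
Definition weight (l : \bar R) : R := fine (expeR (- l)).

Lemma weight_ge0 l : 0 <= weight l.
Proof. by rewrite fine_ge0// expeR_ge0. Qed.

Lemma expeRN_weight l : (0 <= l)%E -> expeR (- l) = (weight l)%:E.
Proof. by case: l. Qed.

(** Source of both the letter inequality and its equality case: the slack is [x] times the gap in
    [1 + s <= expR s] at [s = ln (N / x) - r]. *)
Let slack_real (x r : R) : 0 < x ->
  x * r - (x * ln (N / x) + x - N * expR (- r)) =
  x * (expR (ln (N / x) - r) - (1 + (ln (N / x) - r))).
Proof.
move=> x0; have -> : N * expR (- r) = x * expR (ln (N / x) - r).
  by rewrite expRD lnK ?posrE ?divr_gt0// mulrA mulrCA divff ?mulr1// gt_eqF.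
by rewrite !mulrDr !mulrN !mulrDr !opprD !mulrN !opprK mulr1; ring.
Qed.

Lemma letter_cost_ge (x : R) (l : \bar R) : 0 <= x -> (0 <= l)%E ->
  ((x * ln (N / x) + x - N * weight l)%:E <= l * x%:E)%E.
Proof.
rewrite le_eqVlt => /predU1P[<- _|x0].
  by rewrite mule0 mul0r !add0r lee_fin oppr_le0 mulr_ge0 ?weight_ge0// ltW.
case: l => [r _| _|//]; last by rewrite gt0_mulye ?leey.
rewrite -EFinM lee_fin (mulrC r) -subr_ge0 slack_real//.
by rewrite mulr_ge0 ?subr_ge0 ?expR_ge1Dx// ltW.
Qed.

Lemma letter_cost_eq (x : R) (l : \bar R) : 0 <= x -> (0 <= l)%E ->
  (x * ln (N / x) + x - N * weight l)%:E = (l * x%:E)%E ->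
  l = lne (N%:E / x%:E)%E.
Proof.
rewrite le_eqVlt => /predU1P[<- l0|x0].
  (* At [x = 0] the equality reads [- (N * weight l) = 0], which forces [l = +oo], the Shannon
     length of a null letter. *)
  rewrite mule0 mul0r !add0r inve0 gt0_muley ?lte_fin// => -[/eqP].
  rewrite oppr_eq0 mulf_eq0 gt_eqF//= => /eqP w0; move: (expeRN_weight l0).
  by rewrite w0 => /eqP; rewrite expeR_eq0 => /eqP/(congr1 oppe); rewrite oppeK.
case: l => [r _| _|//]; last by rewrite gt0_mulye.
rewrite -EFinM => -[/esym/eqP]; rewrite (mulrC r) -subr_eq0 slack_real//.
rewrite mulf_eq0 gt_eqF//= subr_eq0 => /eqP e.
have {e} : ln (N / x) - r = 0.
  by apply/eqP; apply: contra_eqT e => s0; rewrite gt_eqF// expR_gt1Dx.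
rewrite inver gt_eqF// -EFinM lne_EFin ?divr_gt0// => /eqP.
by rewrite subr_eq0 => /eqP ->.
Qed.

Lemma letter_cost_lne (x : R) : 0 <= x ->
  (lne (N%:E / x%:E) * x%:E)%E = (x * ln (N / x))%:E.
Proof.
rewrite le_eqVlt => /predU1P[<-|x0]; first by rewrite mule0 mul0r.
by rewrite inver gt_eqF// -EFinM lne_EFin ?divr_gt0// -EFinM mulrC.
Qed.

Lemma expeRN_lne (x : R) : 0 <= x ->
  expeR (- lne (N%:E / x%:E)) = (x / N)%:E.
Proof.
rewrite le_eqVlt => /predU1P[<-|x0].
  by rewrite mul0r inve0 gt0_muley ?lte_fin.
rewrite inver gt_eqF// -EFinM lne_EFin ?divr_gt0//= expRN lnK ?invf_div//.
by rewrite posrE divr_gt0.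
Qed.

End LetterCost.

Section Gibbs.
Variables (R : realType) (A : finType).
Implicit Types (nu : mass R A) (ell : A -> \bar R).

Lemma total_massE nu : total_mass nu = \sum_a (nu a : R).
Proof. by rewrite /total_mass /measure_of; apply: eq_bigl => a; rewrite inE. Qed.

Lemma total_mass_ge0 nu : (forall a, 0 <= nu a) -> 0 <= total_mass nu.
Proof. by move=> nu0; rewrite total_massE sumr_ge0. Qed.

Lemma mass_le_total nu a : (forall b, 0 <= nu b) -> nu a <= total_mass nu.
Proof.
by move=> nu0; rewrite total_massE (bigD1 a)//= lerDl sumr_ge0.
Qed.

Lemma entropyE nu : (forall a, 0 <= nu a) -> 0 < total_mass nu ->
  entropy nu = \sum_a (nu a : R) * ln (total_mass nu / (nu a : R)).
Proof.
move=> nu0 N0; rewrite /entropy /prob_entropy mulrN mulr_sumr -sumrN.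
apply: eq_bigr => a _; rewrite ffunE /GRing.scale/= mulrA mulVKf ?gt_eqF//.
have [->|na] := eqVneq (nu a) 0; first by rewrite !mul0r oppr0.
have na0 : 0 < nu a by rewrite lt_neqAle eq_sym na nu0.
rewrite -mulrN -lnV ?posrE ?mulr_gt0 ?invr_gt0//.
by rewrite invfM invrK.
Qed.

Lemma kraft_sum_weight ell : kraft ell -> \sum_a weight (ell a) <= 1.
Proof.
case=> l0; under eq_bigr do rewrite expeRN_weight//.
by rewrite sumEFin lee_fin.
Qed.

(** The added terms [nu a] sum to the total mass, and by Kraft the subtracted ones sum to at most
    that. *)
Lemma entropy_le_slack nu ell : (forall a, 0 <= nu a) -> 0 < total_mass nu ->
  kraft ell ->
  entropy nu <= \sum_a ((nu a : R) * ln (total_mass nu / (nu a : R)) + nu a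
                        - total_mass nu * weight (ell a)).
Proof.
move=> nu0 N0 kl; rewrite entropyE// !big_split/= sumrN -mulr_sumr -total_massE.
by rewrite -addrA lerDl subr_ge0 ler_piMr ?(ltW N0)// kraft_sum_weight.
Qed.

Lemma code_cost_ge0 nu ell : (forall a, 0 <= nu a) -> (forall a, 0 <= ell a)%E ->
  (0 <= code_cost ell nu)%E.
Proof. by move=> nu0 l0; apply: sume_ge0 => a _; rewrite mule_ge0 ?lee_fin. Qed.

Lemma entropy_le_code_cost nu ell : (forall a, 0 <= nu a) -> kraft ell ->
  ((entropy nu)%:E <= code_cost ell nu)%E.
Proof.
move=> nu0 kl; have l0 := kl.1.
(* Admitting zero mass, where the entropy is 0, spares a proof that every element of the hull has
   positive mass. *)
have := total_mass_ge0 nu0; rewrite le_eqVlt => /predU1P[N0|N0].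
  by rewrite /entropy -N0 mul0r code_cost_ge0.
rewrite (le_trans (y := (\sum_a ((nu a : R) * ln (total_mass nu / (nu a : R)) + nu a
                        - total_mass nu * weight (ell a)))%:E))//.
  by rewrite lee_fin entropy_le_slack.
by rewrite -sumEFin; apply: lee_sum => a _; exact: letter_cost_ge.
Qed.

Lemma code_cost_le_entropy nu ell : (forall a, 0 <= nu a) -> 0 < total_mass nu ->
  kraft ell -> (code_cost ell nu <= (entropy nu)%:E)%E ->
  forall a, ell a = lne ((total_mass nu)%:E / (nu a)%:E)%E.
Proof.
move=> nu0 N0 kl cH a; have l0 := kl.1; apply: letter_cost_eq => //.
(* The cost is at most the entropy, hence at most the sum of the letter bounds, so each bound is
   attained. *)
move: a; apply: sume_le_eq => // [a|]; first exact: letter_cost_ge.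
by rewrite (le_trans cH)// sumEFin lee_fin entropy_le_slack.
Qed.

(** Lengths are nonnegative since no letter outweighs the total mass; the weights are the normalized
    masses, which sum to 1. *)
Lemma shannon_code_kraft nu : (forall a, 0 <= nu a) -> 0 < total_mass nu ->
  kraft (fun a => lne ((total_mass nu)%:E / (nu a)%:E)%E).
Proof.
move=> nu0 N0; split=> [a|].
  rewrite lne_ge0; have := nu0 a; rewrite le_eqVlt => /predU1P[<-|na0].
    by rewrite inve0 gt0_muley ?lte_fin// leey.
  by rewrite inver gt_eqF// -EFinM lee_fin ler_pdivlMr// mul1r mass_le_total.
under eq_bigr do rewrite expeRN_lne//.
by rewrite sumEFin -mulr_suml -total_massE divff// gt_eqF.
Qed.

Lemma shannon_code_cost nu : (forall a, 0 <= nu a) -> 0 < total_mass nu ->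
  code_cost (fun a => lne ((total_mass nu)%:E / (nu a)%:E)%E) nu
  = (entropy nu)%:E.
Proof.
move=> nu0 N0; rewrite entropyE// -[RHS]sumEFin.
by apply: eq_bigr => a _; rewrite letter_cost_lne.
Qed.

(** Letters may have infinite length, so distributing products over sums relies on all terms being
    nonnegative. *)
Lemma code_cost_mix (Omega : finType) (mu : Omega -> mass R A) (p : Omega -> R)
    ell :
  (forall w a, 0 <= mu w a) -> (forall w, 0 <= p w) -> (forall a, 0 <= ell a)%E ->
  code_cost ell (\sum_w p w *: mu w)
  = (\sum_w (p w)%:E * code_cost ell (mu w))%E.
Proof.
move=> mu0 p0 l0.
rewrite /code_cost; under [LHS]eq_bigr do rewrite sum_ffunE -sumEFin.
under [LHS]eq_bigr => a _.
  rewrite ge0_sume_distrr; last by move=> w _; rewrite lee_fin ffunE mulr_ge0.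
  over.
rewrite exchange_big/=; apply: eq_bigr => w _.
rewrite ge0_sume_distrr; last by move=> a _; rewrite mule_ge0 ?lee_fin.
by apply: eq_bigr => a _; rewrite ffunE EFinM muleCA.
Qed.

Lemma nonneg_convex : convex_set [set nu : mass R A | forall a, 0 <= nu a].
Proof.
move=> x y k; rewrite !inE => x0 y0 a.
rewrite [conv k x y]/(k%:num *: (x : mass R A) + (1 - k%:num) *: (y : mass R A)).
by rewrite !ffunE addr_ge0// mulr_ge0// ?subr_ge0//.
Qed.

Lemma empirical_ge0 nu a : empirical nu -> 0 <= nu a.
Proof. by move=> /(_ [set a]%SET); rewrite /measure_of big_set1 => /natr_ge0. Qed.

End Gibbs.

Theorem theorem7 (R : realType) (A Omega : finType) (mu : Omega -> mass R A)
    (C : set (mass R A)) (mustar : mass R A) (ellstar : A -> \bar R) (c : R)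
    (p : Omega -> R)
    (Omega_nonempty : (0 < #|Omega|)%N)
    (mu_empirical : forall w, empirical (mu w))
    (mu_nonzero : forall w, mu w != 0)
    (C_def : C = convex_hull (range mu))
    (mustar_in : C mustar)
    (ellstar_in : kraft ellstar)
    (cost_le : forall nu, C nu -> (code_cost ellstar nu <= c%:E)%E)
    (cost_ge : forall ell, kraft ell -> (c%:E <= code_cost ell mustar)%E)
    (p_ge0 : forall w, 0 <= p w)
    (p_sum : \sum_w p w = 1)
    (mustar_mix : mustar = \sum_w p w *: mu w) :
  [/\ forall w, 0 < p w -> code_cost ellstar (mu w) = c%:E,
      C mustar /\ (forall nu, C nu -> entropy nu <= entropy mustar)
    & forall a,
        ellstar a = lne ((total_mass mustar)%:E / (mustar a)%:E)%E].
Proof.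
have mu0 w a : 0 <= mu w a by exact: empirical_ge0.
have hull0 nu : C nu -> forall a, 0 <= nu a.
  (* Minimality of the hull: the nonnegative masses form a convex set containing every [mu w]. *)
  suff : C `<=` [set nu | forall a, 0 <= nu a] by apply.
  rewrite C_def; apply: smallest_sub; first exact: nonneg_convex.
  by move=> _ [w _ <-].
have mustar0 := hull0 _ mustar_in.
have [w pw] : exists w, 0 < p w.
  apply: contrapT => /forallNP np; move: p_sum; rewrite big1 => [/eqP|w _].
    by rewrite eq_sym oner_eq0.
  by apply/eqP; rewrite eq_le p_ge0 leNgt andbT; apply/negP.
(* A letter charged by [mu w], with [p w] positive, is also charged by the mixture. *)
have N0 : 0 < total_mass mustar.
  have [a mua] : exists a, mu w a != 0.
    apply: contrapT => /forallNP nz; case/negP: (mu_nonzero w).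
    by apply/eqP/ffunP => a; rewrite ffunE; apply/eqP/negP => /negP/nz.
  rewrite (lt_le_trans _ (mass_le_total a mustar0))// mustar_mix sum_ffunE.
  rewrite (bigD1 w)//= ltr_pwDl ?sumr_ge0// => [|v _].
    by rewrite ffunE mulr_gt0// lt_neqAle eq_sym mua mu0.
  by rewrite ffunE mulr_ge0.
have cH : (c%:E <= (entropy mustar)%:E)%E.
  by rewrite -shannon_code_cost//; apply/cost_ge/shannon_code_kraft.
have l0 := ellstar_in.1.
split=> [v pv||].
- have Cmu u : C (mu u) by rewrite C_def; apply: sub_gen_smallest; exists u.
  (* Finiteness serves both the termwise comparison below and the cancellation of [p v] in [R]. *)
  have cfin u : code_cost ellstar (mu u) \is a fin_num.
    by rewrite ge0_fin_numE ?code_cost_ge0// (le_lt_trans (cost_le _ (Cmu u)))// ltry.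
  (* The left sides sum to the cost of [mustar], at least [c], and the right sides sum to [c]. *)
  have : forall u, ((p u)%:E * code_cost ellstar (mu u) = (p u)%:E * c%:E)%E.
    apply: sume_le_eq => [u|u|]; first by rewrite fin_numM.
      by rewrite lee_wpmul2l ?lee_fin// cost_le.
    rewrite -code_cost_mix// -mustar_mix; under eq_bigr do rewrite -EFinM.
    by rewrite sumEFin -mulr_suml p_sum mul1r cost_ge.
  move=> /(_ v); rewrite -[code_cost _ _]fineK// -!EFinM => -[].
  by move=> /mulfI ->//; rewrite gt_eqF.
- split=> // nu Cnu; rewrite -lee_fin (le_trans _ cH)//.
  by rewrite (le_trans _ (cost_le _ Cnu))// entropy_le_code_cost//; exact: hull0.
- apply: code_cost_le_entropy => //.
  by rewrite (le_trans (cost_le _ mustar_in)).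
Qed.
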